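(* Let $p\in(1,\infty)$, $p'=\frac p{p-1}$, and $1<q\le r<\infty$. Then the Laplace transform $L:L^{p,q}(0,\infty)\to L^{p',r}(0,\infty)$ is maximally non-compact, i.e. $\alpha(L)=\|L\|$.
   Context: Laplace transform: $Lf(t)=\int_0^\infty f(s)e^{-ts}\,ds$, $t\in(0,\infty)$; it is bounded $L^{p,q}(0,\infty)\to L^{p',q}(0,\infty)\hookrightarrow L^{p',r}(0,\infty)$. Lorentz space $L^{p,q}(0,\infty)$: measurable $f$ with $\|f\|_{p,q}=\big(\int_0^\infty(t^{1/p}f^*(t))^q\frac{dt}t\big)^{1/q}<\infty$, $f^*$ the nonincreasing rearrangement. For a bounded linear $T:X\to Y$, the ball measure of non-compactness $\alpha(T)$ is the infimum of all $\rho>0$ such that $T(B_X)$ (image of the closed unit ball) can be covered by finitely many balls of radius $\rho$ in $Y$; $T$ is maximally non-compact if $\alpha(T)=\|T\|$. *)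

(* Defs.v *)
From HB Require Import structures.
From mathcomp Require Import all_boot all_order all_algebra.
From mathcomp Require Import all_classical all_reals all_analysis.
Set Implicit Arguments. Unset Strict Implicit. Unset Printing Implicit Defensive.
Import Order.TTheory GRing.Theory Num.Theory.
Import numFieldNormedType.Exports.
Local Open Scope classical_set_scope.
Local Open Scope ring_scope.

Section Lorentz.
Context {R : realType}.

Definition halfline : set R := `]0, +oo[.

Definition distf (f : R -> R) (s : R) : \bar R :=
  lebesgue_measure (halfline `&` [set t | s < `|f t|]).

(* nonincreasing rearrangement f^*(t) = inf {s >= 0 : d_f(s) <= t} (inf of empty = +oo) *)
Definition rearr (f : R -> R) (t : R) : \bar R :=
  ereal_inf [set s%:E | s in [set s : R | 0 <= s /\ (distf f s <= t%:E)%E]].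

Definition lorentz_norm (p q : R) (f : R -> R) : \bar R :=
  poweR (\int[lebesgue_measure]_(t in halfline)
           (poweR ((t `^ p^-1)%:E * rearr f t)%E q * (t^-1)%:E)%E) q^-1.

Definition in_lorentz (p q : R) (f : R -> R) : Prop :=
  measurable_fun halfline f /\ (lorentz_norm p q f < +oo)%E.

Definition lorentz_ball (p q : R) (f : R -> R) : Prop :=
  in_lorentz p q f /\ (lorentz_norm p q f <= 1)%E.

Definition laplace (f : R -> R) (t : R) : R :=
  Rintegral lebesgue_measure halfline (fun s => f s * expR (- (t * s))).

Definition laplace_norm (p q p' r : R) : \bar R :=
  ereal_sup [set lorentz_norm p' r (laplace f) | f in lorentz_ball p q].

Definition laplace_alpha (p q p' r : R) : \bar R :=
  ereal_inf [set rho%:E | rho in [set rho : R | 0 < rho /\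
    exists (n : nat) (g : nat -> R -> R),
      (forall i, (i < n)%N -> in_lorentz p' r (g i)) /\
      (forall f, lorentz_ball p q f ->
         exists i, (i < n)%N /\
           (lorentz_norm p' r (fun t => (laplace f t - g i t)%R) <= rho%:E)%E)]].

End Lorentz.

(* Main.v *)
Require Import Defs.
From HB Require Import structures.
From mathcomp Require Import all_boot all_order all_algebra.
From mathcomp Require Import all_classical all_reals all_analysis.
From mathcomp Require Import measurable_realfun measurable_fun_approximation ring.
Set Implicit Arguments. Unset Strict Implicit. Unset Printing Implicit Defensive.
Import Order.TTheory GRing.Theory Num.Theory.
Local Open Scope ring_scope.
Local Open Scope classical_set_scope.
Local Open Scope ereal_scope.

(* The dilations [D_a f x = a `^ p^-1 * f (a * x)] are isometries of [L^{p,q}], and the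
   Laplace transform intertwines [D_a] on [L^{p,q}] with [D_(1/a)] on [L^{p',r}].
   For [g] in [L^{p',r}], [t `^ p'^-1 * rearr g t] tends to [0] at infinity, hence [D_a g]
   tends to [0] in measure as [a] tends to infinity.  If finitely many balls
   of radius [rho] and centers [g_i] cover the image of the unit ball, then for every [f] in
   the unit ball and every large [a], the function [laplace f] lies within [rho] of some
   [D_a g_i].  The quasi-norm of [L^{p',r}] is lower semicontinuous with respect to
   convergence in measure, so the norm of [laplace f] is at most [rho].
   All estimates of distribution functions use Lebesgue outer measure only, so the
   measurability of [laplace f] never matters. *)

(** * Dilations of Lebesgue measure *)

(** Lebesgue measure is used as an outer measure here, so [A] is arbitrary. A cover of [A] by
    half-open intervals pulls back to a cover of the dilated set, and every length is divided by
    [b]. *)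
Lemma lebesgue_measure_dilation_le {R : realType} (b : R) (A : set R) : (0 < b)%R ->
  b%:E * lebesgue_measure [set x : R | A (b * x)%R] <= lebesgue_measure A.
Proof.
move=> b0; apply: le_ereal_inf_tmp => _ [F [mF AF] <-].
have pre (x y : R) : [set t : R | `]x, y]%classic (b * t)%R] =
    `](b^-1 * x)%R, (b^-1 * y)%R]%classic.
  by apply/seteqP; split=> t /=; rewrite !in_itv/= ltr_pdivrMl// ler_pdivlMl.
have len k : wlength idfun [set t : R | F k (b * t)%R] = b^-1%:E * wlength idfun (F k).
  have [[x y] _ <-] := mF k.
  rewrite pre !wlength_itv/= !lte_fin ltr_pM2l ?invr_gt0//.
  by case: ifP => _; rewrite ?mule0// -!EFinB -EFinM mulrBr.
rewrite -lee_pdivlMl//.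
rewrite -nneseriesZl//.
under eq_eseriesr do rewrite -len.
apply: ereal_inf_lbound.
exists (fun k => [set t : R | F k (b * t)%R]) => //; split.
  by move=> k; have [[x y] _ <-] := mF k; rewrite pre; exists ((b^-1 * x)%R, (b^-1 * y)%R).
by move=> t At; have [k _ Fk] := AF _ At; exists k.
Qed.

Lemma lebesgue_measure_dilation {R : realType} (b : R) (A : set R) : (0 < b)%R ->
  lebesgue_measure [set x : R | A (b * x)%R] = b^-1%:E * lebesgue_measure A.
Proof.
move=> b0; apply/eqP; rewrite eq_le; apply/andP; split.
  by rewrite lee_pdivlMl//; exact: lebesgue_measure_dilation_le.
(* The reverse inequality is the same one for [b^-1], applied to the dilated set. *)
have := @lebesgue_measure_dilation_le R b^-1 [set x : R | A (b * x)%R].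
by rewrite invr_gt0 => /(_ b0); under eq_set do rewrite /= mulVKf ?gt_eqF//.
Qed.

Lemma halfline_dilation {R : realType} (b : R) : (0 < b)%R ->
  [set x : R | halfline (b * x)%R] = halfline.
Proof. by move=> b0; apply/seteqP; split=> t; rewrite /halfline /= !in_itv/= !andbT pmulr_rgt0. Qed.

Lemma measurable_halfline {R : realType} : measurable (@halfline R).
Proof. exact: measurable_itv. Qed.

Lemma measurable_fun_dilation d (T : measurableType d) {R : realType} (b : R) (f : R -> T) :
  (0 < b)%R -> measurable_fun halfline f ->
  measurable_fun halfline (fun x => f (b * x)%R).
Proof.
move=> b0 mf; apply: (measurable_comp (F := halfline)) => //.
- exact: measurable_halfline.
- by move=> _ [t /= + <-]; rewrite /halfline/= !in_itv/= !andbT; rewrite pmulr_rgt0.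
Qed.

(** The pushforward of Lebesgue measure under multiplication by [b] is [b^-1] times Lebesgue
    measure. *)
Lemma ge0_integral_dilation {R : realType} (b : R) (F : R -> \bar R) : (0 < b)%R ->
  measurable_fun halfline F -> (forall x, halfline x -> 0 <= F x) ->
  \int[lebesgue_measure]_(x in halfline) F (b * x)%R =
  b^-1%:E * \int[lebesgue_measure]_(x in halfline) F x.
Proof.
move=> b0 mF F0.
have mphi : measurable_fun setT (fun x : measurableTypeR R => (b * x)%R : measurableTypeR R).
  exact: mulrl_measurable.
transitivity (\int[lebesgue_measure]_(x in [set x : R | halfline (b * x)%R]) F (b * x)%R).
  by rewrite halfline_dilation.
have mH := @measurable_halfline R.
have F0' : {in halfline, forall y, 0 <= F y} by move=> y /set_mem/F0.
rewrite -(ge0_integral_pushforward mphi lebesgue_measure mH mF F0').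
have b1 : (0 <= b^-1)%R by rewrite invr_ge0 ltW.
rewrite -(ge0_integral_mscale lebesgue_measure mH (NngNum b1) mF F0).
apply: eq_measure_integral => A mA _.
rewrite /= /mscale/= -lebesgue_measure_dilation//.
Qed.

(** * Nonincreasing rearrangement *)

Lemma distf_le {R : realType} (f : R -> R) (s s' : R) : (s <= s')%R -> distf f s' <= distf f s.
Proof.
by move=> ss'; apply: le_outer_measure => t /= [ht st]; split=> //; exact: le_lt_trans st.
Qed.

Lemma distf_dilation {R : realType} (f : R -> R) (b c s : R) : (0 < b)%R -> (0 < c)%R ->
  distf (fun x => c * f (b * x))%R s = b^-1%:E * distf f (s / c)%R.
Proof.
move=> b0 c0; rewrite /distf -lebesgue_measure_dilation//; congr lebesgue_measure.
apply/seteqP; split => x /=; rewrite -!(in_setE halfline) /halfline !mem_setE !in_itv/= !andbT;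
  by rewrite pmulr_rgt0// normrM (gtr0_norm c0) ltr_pdivrMr// (mulrC c).
Qed.

Lemma rearr_ge0 {R : realType} (f : R -> R) (t : R) : 0 <= rearr f t.
Proof. by apply: le_ereal_inf_tmp => _ [s [s0 _] <-]; rewrite lee_fin. Qed.

Lemma rearr_le {R : realType} (f : R -> R) (t s : R) :
  (0 <= s)%R -> distf f s <= t%:E -> rearr f t <= s%:E.
Proof. by move=> s0 fs; apply: ereal_inf_lbound; exists s. Qed.

(** A strict inequality provides an admissible level below [s], so the infimum need not be
    attained. *)
Lemma distf_rearr {R : realType} (f : R -> R) (t s : R) :
  rearr f t < s%:E -> distf f s <= t%:E.
Proof.
move=> /ereal_inf_lt[_ [s' [_ fs'] <-]]; rewrite lte_fin => /ltW ss'.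
exact: le_trans (distf_le _ ss') fs'.
Qed.

Lemma rearr_nonincreasing {R : realType} (f : R -> R) (t t' : R) :
  (t <= t')%R -> rearr f t' <= rearr f t.
Proof.
move=> tt'; apply: ereal_inf_le_tmp => _ [s [s0 fs] <-]; exists s => //; split=> //.
by apply: le_trans fs _; rewrite lee_fin.
Qed.

Lemma rearr_dilation_le {R : realType} (f : R -> R) (b c t : R) : (0 < b)%R -> (0 < c)%R ->
  rearr (fun x => c * f (b * x))%R t <= c%:E * rearr f (b * t)%R.
Proof.
move=> b0 c0; rewrite -lee_pdivrMl//.
apply: le_ereal_inf_tmp => _ [s [s0 fs] <-].
rewrite lee_pdivrMl// -EFinM; apply: rearr_le; first by rewrite mulr_ge0// ltW.
by rewrite distf_dilation// mulrAC divff ?gt_eqF// mul1r lee_pdivrMl// -EFinM.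
Qed.

Lemma rearr_dilation {R : realType} (f : R -> R) (b c t : R) : (0 < b)%R -> (0 < c)%R ->
  rearr (fun x => c * f (b * x))%R t = c%:E * rearr f (b * t)%R.
Proof.
move=> b0 c0; apply/eqP; rewrite eq_le rearr_dilation_le//=.
have ib0 : (0 < b^-1)%R by rewrite invr_gt0.
have ic0 : (0 < c^-1)%R by rewrite invr_gt0.
(* Dilating back by [b^-1] and [c^-1] turns the upper bound into the lower one. *)
have := @rearr_dilation_le _ (fun x => c * f (b * x))%R _ _ (b * t) ib0 ic0.
rewrite mulKf ?gt_eqF// -lee_pdivrMl// invrK; congr (_ * rearr _ _ <= _).
by apply/funext => x; rewrite mulKf ?gt_eqF// mulVKf ?gt_eqF.
Qed.

(** By monotonicity, superlevel sets of [rearr f] in the half-line are intervals, whatever [f]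
    is. *)
Lemma measurable_rearr {R : realType} (f : R -> R) : measurable_fun halfline (rearr f).
Proof.
move=> mD; apply: (measurability _ (ErealGenOInfty.measurableE R)) => // _ [_ [x ->] <-].
apply: is_interval_measurable => s t [/= hs xs] [/= ht xt] z /andP[sz zt].
split; first by move: hs; rewrite /halfline/= !in_itv/= !andbT => /lt_le_trans; exact.
by move: xt; rewrite !in_itv/= !andbT => /lt_le_trans; apply; exact: rearr_nonincreasing.
Qed.

(** Where |h| > s + e, either |h - g| > s or |g| > e; subadditivity of the outer measure adds [t]
    and [d]. *)
Lemma rearr_addr_le {R : realType} (h g : R -> R) (t d e : R) : (0 <= e)%R ->
  distf g e <= d%:E -> rearr h (t + d)%R <= rearr (fun x => h x - g x)%R t + e%:E.
Proof.
move=> e0 ge; rewrite -leeBlDr//; apply: le_ereal_inf_tmp => _ [s [s0 hgs] <-].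
rewrite leeBlDr// -EFinD; apply: rearr_le; first exact: addr_ge0.
rewrite EFinD; apply: le_trans (leeD hgs ge).
apply: le_trans (outer_measureU2 _ _ _); apply: le_outer_measure => x /= [hx sx].
have [ex|ex] := ltP e `|g x|%R; [by right|left; split=> //=].
rewrite -(ltrD2r e); apply: lt_le_trans sx _; rewrite -lerBlDr.
by apply: le_trans (lerB_dist _ _); rewrite lerB.
Qed.

(** * Lorentz norm and Laplace transform under dilations *)

Lemma halfline_gt0 {R : realType} (t : R) : halfline t <-> (0 < t)%R.
Proof. by rewrite /halfline/= in_itv/= andbT. Qed.

(** The argument [phi] is a general function because both [rearr f] and its lower approximations
    [truncated_rearr f e] are inserted. *)
Definition lorentz_integrand {R : realType} (p q : R) (phi : R -> \bar R) (t : R) : \bar R :=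
  poweR ((t `^ p^-1)%:E * phi t) q * (t^-1)%:E.

Lemma lorentz_integrand_ge0 {R : realType} (p q : R) (phi : R -> \bar R) (t : R) :
  halfline t -> 0 <= lorentz_integrand p q phi t.
Proof. by move=> /halfline_gt0 t0; rewrite mule_ge0 ?poweR_ge0// lee_fin invr_ge0 ltW. Qed.

Lemma measurable_lorentz_integrand {R : realType} (p q : R) (phi : R -> \bar R) :
  measurable_fun halfline phi -> measurable_fun halfline (lorentz_integrand p q phi).
Proof.
move=> mphi; apply: emeasurable_funM.
  apply: (measurableT_comp (@measurable_poweR R q)); apply: emeasurable_funM => //.
  by apply/measurable_EFinP; apply: measurable_funTS; exact: measurable_powR.
apply/measurable_EFinP.
apply: (eq_measurable_fun (fun t => t `^ (-1))%R).
  by move=> t /set_mem/halfline_gt0 t0; rewrite powR_inv1// ltW.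
by apply: measurable_funTS; exact: measurable_powR.
Qed.

Lemma le_poweR {R : realType} (q : R) (x y : \bar R) :
  (0 <= q)%R -> 0 <= x -> x <= y -> x `^ q <= y `^ q.
Proof.
move=> q0 x0 xy; apply: gt0_ler_poweR => //; rewrite in_itv/= leey andbT//.
exact: le_trans xy.
Qed.

Lemma lorentz_integrand_le {R : realType} (p q : R) (phi psi : R -> \bar R) (t : R) :
  (0 <= q)%R -> halfline t -> 0 <= phi t -> phi t <= psi t ->
  lorentz_integrand p q phi t <= lorentz_integrand p q psi t.
Proof.
move=> q0 /halfline_gt0 t0 phi0 le; have psi0 := le_trans phi0 le.
apply: lee_wpmul2r; first by rewrite lee_fin invr_ge0 ltW.
apply: le_poweR => //; first by rewrite mule_ge0// lee_fin powR_ge0.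
by apply: lee_wpmul2l => //; rewrite lee_fin powR_ge0.
Qed.

(** The hypothesis quantified over [z] says that [phi t] is at most the supremum of the [psi n t]. A
    bound on the integrand is equivalent to a bound on its argument, so it passes to this supremum
    without any continuity of powers. *)
Lemma lorentz_integrand_le_sup {R : realType} (p q : R) (phi : R -> \bar R)
    (psi : nat -> R -> \bar R) (t : R) (y : \bar R) :
  (0 < q)%R -> halfline t -> (forall n, 0 <= psi n t) ->
  (forall z, (forall n, psi n t <= z) -> phi t <= z) -> 0 <= phi t ->
  (forall n, lorentz_integrand p q (psi n) t <= y) -> lorentz_integrand p q phi t <= y.
Proof.
move=> q0 /halfline_gt0 t0 psi0 sup phi0 le_y.
have tp0 : (0 < t `^ p^-1)%R by rewrite powR_gt0.
have y0 : 0 <= y by apply: le_trans (le_y 0%N); exact/lorentz_integrand_ge0/halfline_gt0.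
have le_root (a b : \bar R) : 0 <= a -> 0 <= b -> a `^ q <= b -> a <= b `^ q^-1.
  move=> a0 b0 ab; rewrite -[a]poweRe1// -(divff (lt0r_neq0 q0)) poweRrM.
  by apply: le_poweR; rewrite ?invr_ge0 ?poweR_ge0// ltW.
have root_le (a b : \bar R) : 0 <= a -> 0 <= b -> a <= b `^ q^-1 -> a `^ q <= b.
  move=> a0 b0 ab; rewrite -[b]poweRe1// -(mulVf (lt0r_neq0 q0)) poweRrM.
  by apply: le_poweR => //; exact: ltW.
have ty0 : 0 <= t%:E * y by rewrite mule_ge0// lee_fin ltW.
(* The inequality is solved for [x]; the right-hand side does not depend on [x]. *)
have E (x : \bar R) : 0 <= x ->
   ((((t `^ p^-1)%:E * x) `^ q * (t^-1)%:E <= y) =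
     (x <= ((t `^ p^-1)^-1)%:E * (t%:E * y) `^ q^-1)).
  move=> x0; have tx0 : 0 <= (t `^ p^-1)%:E * x by rewrite mule_ge0// lee_fin ltW.
  rewrite muleC lee_pdivrMl// lee_pdivlMl//.
  by apply/idP/idP; [exact: le_root|exact: root_le].
rewrite /lorentz_integrand E//; apply: sup => n; rewrite -E//; exact: le_y.
Qed.

Lemma lorentz_normE {R : realType} (p q : R) (f : R -> R) :
  lorentz_norm p q f =
  (\int[lebesgue_measure]_(t in halfline) lorentz_integrand p q (rearr f) t) `^ q^-1.
Proof. by []. Qed.

Lemma lorentz_norm_dilation {R : realType} (p q b : R) (f : R -> R) : (0 < b)%R ->
  lorentz_norm p q (fun x => b `^ p^-1 * f (b * x))%R = lorentz_norm p q f.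
Proof.
move=> b0; rewrite !lorentz_normE.
suff -> : \int[lebesgue_measure]_(t in halfline)
    lorentz_integrand p q (rearr (fun x => b `^ p^-1 * f (b * x))%R) t =
    \int[lebesgue_measure]_(t in halfline) lorentz_integrand p q (rearr f) t by [].
transitivity (\int[lebesgue_measure]_(t in halfline)
    (b%:E * lorentz_integrand p q (rearr f) (b * t)%R)).
  apply: eq_integral => t /set_mem/halfline_gt0 t0.
  rewrite /lorentz_integrand rearr_dilation ?powR_gt0// powRM ?ltW//.
  rewrite muleA -EFinM (mulrC (t `^ _)%R) muleCA -EFinM.
  by rewrite invfM mulVKf ?gt_eqF.
have mI := measurable_lorentz_integrand p q (measurable_rearr f).
rewrite ge0_integralZl//.
- rewrite ge0_integral_dilation// ?muleA -?EFinM ?divff ?gt_eqF ?mul1e//.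
  by move=> x; exact: lorentz_integrand_ge0.
- exact: measurable_halfline.
- exact: measurable_fun_dilation.
- move=> x /halfline_gt0 x0; apply: lorentz_integrand_ge0.
  by apply/halfline_gt0; rewrite mulr_gt0.
- by rewrite lee_fin ltW.
Qed.

(** This is the substitution of s / b for s. Integrability of the integrand is not assumed, so
    positive and negative parts are transformed separately. *)
Lemma laplace_dilation {R : realType} (b c t : R) (f : R -> R) : (0 < b)%R -> (0 < c)%R ->
  measurable_fun halfline f ->
  laplace (fun x => c * f (b * x))%R t = (c / b * laplace f (t / b))%R.
Proof.
move=> b0 c0 mf; rewrite /laplace /Rintegral.
set F := (fun s => f s * expR (- (t / b * s)))%R.
have mF : measurable_fun halfline (EFin \o F).
  apply/measurable_EFinP; apply: measurable_funM => //.
  apply: measurableT_comp => //; apply: measurableT_comp => //.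
have part (G : R -> \bar R) : measurable_fun halfline G -> (forall x, halfline x -> 0 <= G x) ->
    \int[lebesgue_measure]_(x in halfline) (c%:E * G (b * x)%R) =
    (c / b)%:E * \int[lebesgue_measure]_(x in halfline) G x.
  move=> mG G0; rewrite ge0_integralZl//.
  - by rewrite ge0_integral_dilation// muleA -EFinM.
  - exact: measurable_halfline.
  - exact: measurable_fun_dilation.
  - move=> x /halfline_gt0 x0; apply: G0.
    by apply/halfline_gt0; rewrite mulr_gt0.
  - by rewrite lee_fin ltW.
have cb0 : (0 < c / b)%R by rewrite divr_gt0.
(* [fine] sends both infinities to 0, which is compatible with scaling by a positive constant. *)
have fineZ (x : \bar R) : fine ((c / b)%:E * x) = (c / b * fine x)%R.
  by case: x => [x||]; rewrite ?gt0_muley ?gt0_muleNy ?lte_fin//= mulr0.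
rewrite -fineZ; congr fine.
pose H (x : R) := c%:E * (EFin \o F) (b * x)%R.
have Hpos : H^\+ = fun x => c%:E * (EFin \o F)^\+ (b * x)%R.
  by apply/funext => x; rewrite !funeposE maxe_pMr ?mule0// ltW.
have Hneg : H^\- = fun x => c%:E * (EFin \o F)^\- (b * x)%R.
  by apply/funext => x; rewrite !funenegE -muleN maxe_pMr ?mule0// ltW.
transitivity (\int[lebesgue_measure]_(x in halfline) H x).
  apply: eq_integral => x _; rewrite /H /= -EFinM mulrA; congr (_ * expR (- _))%:E.
  by rewrite mulrA divfK ?gt_eqF.
rewrite (integralE lebesgue_measure halfline H)
  (integralE lebesgue_measure halfline (EFin \o F)) Hpos Hneg.
rewrite !part//; [|exact: measurable_funeneg|exact: measurable_funepos].
(* Infinite values of the two parts are included; a positive factor also preserves the conventional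
   value of +oo - +oo. *)
move: (\int[_]_(_ in _) _^\+ _) (\int[_]_(_ in _) _^\- _) => [x||] [y||];
  rewrite ?gt0_muley ?gt0_muleNy ?lte_fin//=.
by congr EFin; rewrite mulrBr.
Qed.

(** * Lower semicontinuity of the Lorentz norm *)

(** A lower approximation of [rearr h t], increasing to it as [e] decreases to 0. Shifting both
    argument and level by [e] makes it insensitive to subtracting a function that is [e]-small in
    measure; the maximum with 0 keeps powers monotone. *)
Definition truncated_rearr {R : realType} (h : R -> R) (e : R) (t : R) : \bar R :=
  maxe (rearr h (t + e)%R - e%:E) 0.

Lemma measurable_truncated_rearr {R : realType} (h : R -> R) (e : R) : (0 <= e)%R ->
  measurable_fun halfline (truncated_rearr h e).
Proof.
move=> e0; apply: measurable_maxe => //; apply: emeasurable_funB => //.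
apply: (measurable_comp (F := halfline)) => //.
- exact: measurable_halfline.
- by move=> _ [t /halfline_gt0 t0 <-]; apply/halfline_gt0; rewrite ltr_wpDr.
- exact: measurable_rearr.
- exact: measurable_funD.
Qed.

Lemma truncated_rearr_le {R : realType} (h g : R -> R) (t e : R) : (0 <= e)%R ->
  distf g e <= e%:E -> truncated_rearr h e t <= rearr (fun x => h x - g x)%R t.
Proof.
move=> e0 ge; rewrite /truncated_rearr ge_max rearr_ge0 andbT leeBlDr//.
exact: rearr_addr_le.
Qed.

(** This is the right-continuity of the rearrangement, obtained with one slack [e] in the level and
    another slack [d] in the argument. *)
Lemma rearr_le_sup {R : realType} (h : R -> R) (t : R) (y : \bar R) :
  (forall n, truncated_rearr h n.+1%:R^-1 t <= y) -> rearr h t <= y.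
Proof.
move=> le_y.
have y0 : 0 <= y by apply: le_trans (le_y 0%N); rewrite /truncated_rearr le_max lexx orbT.
case: y y0 le_y => [y||]; [|by move=> *; rewrite leey|by []].
rewrite lee_fin => y0 le_y.
apply/lee_addgt0Pr => e e0; rewrite -EFinD; apply: rearr_le; first by rewrite addr_ge0// ltW.
apply/lee_addgt0Pr => d d0; rewrite -EFinD.
(* One index makes [n.+1%:R^-1] smaller than both slacks. *)
pose n := Num.truncn (Num.max e^-1 d^-1)%R.
have nP : (Num.max e^-1 d^-1 < n.+1%:R)%R.
  exact: truncnS_gt.
move: nP; rewrite gt_max => /andP[ne nd].
have n0 : (0 < n.+1%:R :> R)%R by [].
have ne' : (n.+1%:R^-1 < e)%R by rewrite invf_plt ?posrE.
have nd' : (n.+1%:R^-1 < d)%R by rewrite invf_plt ?posrE.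
have : rearr h (t + n.+1%:R^-1)%R < (y + e)%:E.
  have := le_y n; rewrite /truncated_rearr ge_max => /andP[+ _].
  rewrite leeBlDr// => /le_lt_trans; apply; rewrite -EFinD lte_fin ltrD2l//.
move/distf_rearr/le_trans; apply; rewrite lee_fin lerD2l; exact: ltW.
Qed.

(** Monotone convergence: the truncated integrands increase with [n], and their limit dominates the
    integrand of [rearr h]. *)
Lemma lorentz_integral_truncated_le {R : realType} (p q : R) (h : R -> R) (M : \bar R) :
  (0 < q)%R ->
  (forall n, \int[lebesgue_measure]_(t in halfline)
     lorentz_integrand p q (truncated_rearr h n.+1%:R^-1) t <= M) ->
  \int[lebesgue_measure]_(t in halfline) lorentz_integrand p q (rearr h) t <= M.
Proof.
move=> q0 le_M.
pose G n := lorentz_integrand p q (truncated_rearr h n.+1%:R^-1).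
have tr0 e t : 0 <= truncated_rearr h e t by rewrite /truncated_rearr le_max lexx orbT.
have mG n : measurable_fun halfline (G n).
  by apply: measurable_lorentz_integrand; exact: measurable_truncated_rearr.
have G0 n t : halfline t -> 0 <= G n t by exact: lorentz_integrand_ge0.
have ndG t : halfline t -> nondecreasing_seq (G ^~ t).
  move=> ht m n mn; apply: lorentz_integrand_le => //; first exact: ltW.
  have nm : (n.+1%:R^-1 <= m.+1%:R^-1 :> R)%R by rewrite lef_pV2 ?posrE// ler_nat.
  rewrite /truncated_rearr; apply: le_max2 => //; apply: leeB; last by rewrite lee_fin.
  by apply: rearr_nonincreasing; rewrite lerD2l.
have mlim : measurable_fun halfline (fun t => limn (G ^~ t)).
  apply: (emeasurable_fun_cvg G) => // t ht.
  by apply: ereal_nondecreasing_is_cvgn; exact: ndG.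
have cvG := @cvg_monotone_convergence _ _ R lebesgue_measure _ (@measurable_halfline R) G mG G0 ndG.
have le_lim : \int[lebesgue_measure]_(t in halfline) limn (G ^~ t) <= M.
  rewrite -(cvg_lim _ cvG)//; apply: lime_le; first by apply/cvg_ex; eexists; exact: cvG.
  by apply: nearW => n; exact: le_M.
apply: le_trans le_lim; apply: ge0_le_integral => //.
- exact: measurable_halfline.
- by move=> t; exact: lorentz_integrand_ge0.
- by apply: measurable_lorentz_integrand; exact: measurable_rearr.
move=> t ht; apply: (lorentz_integrand_le_sup (psi := fun n => truncated_rearr h n.+1%:R^-1)) => //.
- by move=> z; exact: rearr_le_sup.
- exact: rearr_ge0.
move=> n; apply: lime_ge; first by apply: ereal_nondecreasing_is_cvgn; exact: ndG.
by near=> m; apply: ndG => //; near: m; exists n.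
Unshelve. all: by end_near. Qed.

(** * Dilations tend to zero in measure *)

(** Otherwise, beyond every n some interval has integral at least [e], so the integral over ]0, n]
    is at most the total minus [e]. Letting n tend to infinity contradicts finiteness of the
    total. *)
Lemma integral_tail_lt {R : realType} (F : R -> \bar R) (e : R) : (0 < e)%R ->
  measurable_fun halfline F -> (forall t, halfline t -> 0 <= F t) ->
  \int[lebesgue_measure]_(t in halfline) F t < +oo ->
  exists N : nat, forall x y : R, (N%:R <= x)%R ->
    \int[lebesgue_measure]_(t in `]x, y]) F t < e%:E.
Proof.
move=> e0 mF F0 Foo; apply: contrapT => noN.
have mH := @measurable_halfline R.
set I := \int[lebesgue_measure]_(t in halfline) F t in Foo.
have I0 : 0 <= I by exact: integral_ge0.
have Ifin : I \is a fin_num by rewrite ge0_fin_numE.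
pose A (n : nat) : set R := `]0%R, n%:R].
have mA n : measurable (A n) by exact: measurable_itv.
have AH n : A n `<=` halfline.
  by move=> t; rewrite /A /= in_itv/= => /andP[t0 _]; exact/halfline_gt0.
have mFA n : measurable_fun (A n) F by exact: measurable_funS mF.
have bigA : \bigcup_n A n = halfline.
  apply/seteqP; split => [t [n _ /AH]//|t /halfline_gt0 t0].
  exists (Num.truncn t).+1 => //; rewrite /A /= in_itv/= t0/=; exact/ltW/truncnS_gt.
have ndA : nondecreasing_seq A.
  move=> m n mn; apply/subsetPset => t; rewrite /A /= !in_itv/= => /andP[-> /le_trans]; apply.
  by rewrite ler_nat.
have F0A n t : A n t -> 0 <= F t by move=> /AH; exact: F0.
have cvI := @ge0_nondecreasing_set_cvg_integral _ (measurableTypeR R) R A F lebesgue_measure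
  ndA mA mFA F0A.
rewrite bigA in cvI.
suff : I <= I - e%:E.
  by rewrite -{1}[I]fineK// -[I in I - _]fineK// -EFinB lee_fin lerDl oppr_ge0 leNgt e0.
have limI : limn (fun n => \int[lebesgue_measure]_(t in A n) F t) = I by exact: cvg_lim cvI.
rewrite -{1}limI; apply: lime_le; first by apply/cvg_ex; eexists; exact: cvI.
apply: nearW => n; rewrite leeBrDr//.
apply: contrapT => /negP; rewrite -ltNge => ltI; apply: noN; exists n => x y nx.
rewrite ltNge; apply/negP => ele.
move: ltI; apply/negP; rewrite -leNgt.
apply: (@le_trans _ _ (\int[lebesgue_measure]_(t in A n `|` `]x, y]) F t)); last first.
  apply: ge0_subset_integral => //; first by apply: measurableU => //; exact: measurable_itv.
  move=> t [/AH//|/=]; rewrite in_itv/= => /andP[xt _]; apply/halfline_gt0.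
  by apply: le_lt_trans xt; apply: le_trans nx.
rewrite ge0_integral_setU//=; first by rewrite leeD.
- exact: mA.
- apply: measurable_funS mF => // t [/AH//|/=]; rewrite in_itv/= => /andP[xt _]; apply/halfline_gt0.
  by apply: le_lt_trans xt; apply: le_trans nx.
- move=> t [/F0A//|/=]; rewrite in_itv/= => /andP[xt _]; apply/F0/halfline_gt0.
  by apply: le_lt_trans xt; apply: le_trans nx.
apply/disj_setPS => t [] /=; rewrite /A /= !in_itv/= => /andP[_ tn] /andP[xt _].
by move: (lt_le_trans xt tn); rewrite ltNge nx.
Qed.

(* If the conclusion fails at [a], then monotonicity of [rearr g] bounds the integral of the
   Lorentz integrand over (ad/2, ad] below by the constant [K / 2] independent of [a]. *)
Lemma distf_dilation_le {R : realType} (p q : R) (g : R -> R) (e d : R) :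
  (0 < p)%R -> (0 < q)%R -> (0 < e)%R -> (0 < d)%R -> in_lorentz p q g ->
  exists A : R, forall a : R, (0 < a)%R -> (A <= a)%R ->
    distf (fun x => a `^ p^-1 * g (a * x))%R e <= d%:E.
Proof.
move=> p0 q0 e0 d0 [mg gfin].
pose F := lorentz_integrand p q (rearr g).
have mF : measurable_fun halfline F.
  by apply: measurable_lorentz_integrand; exact: measurable_rearr.
have F0 t : halfline t -> 0 <= F t by exact: lorentz_integrand_ge0.
have Foo : \int[lebesgue_measure]_(t in halfline) F t < +oo.
  move: gfin; rewrite lorentz_normE; apply: lty_poweRy.
  by rewrite invr_eq0 gt_eqF.
pose K := (((d / 2) `^ p^-1 * e) `^ q)%R.
have d20 : (0 < d / 2)%R by rewrite divr_gt0.
have K0 : (0 < K)%R by rewrite powR_gt0// mulr_gt0// powR_gt0.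
have K20 : (0 < K / 2)%R by rewrite divr_gt0.
have [N tailN] := integral_tail_lt K20 mF F0 Foo.
(* This threshold puts the left end a * (d / 2) of the test interval beyond [N]. *)
exists (N%:R / (d / 2))%R => a a0; rewrite ler_pdivrMr// => Na.
apply: distf_rearr; rewrite rearr_dilation ?powR_gt0// ltNge; apply/negP => ge_e.
have := tailN _ (a * d)%R Na; rewrite ltNge => /negP; apply.
have ad2 : (a * d - a * (d / 2) = (a * d) / 2)%R by field.
have mH := @measurable_halfline R.
have ad0 : (0 < a * d)%R by rewrite mulr_gt0.
(* The interval has length a * d / 2, and on it 1/t is at least 1 / (a * d). *)
have le1 : ((K / 2)%:E <= \int[lebesgue_measure]_(t in `](a * (d / 2))%R, (a * d)%R])
    cst ((K / (a * d))%:E) t).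
  rewrite integral_cst//= lebesgue_measure_itv/= lte_fin.
  rewrite -subr_gt0 ad2 divr_gt0// -EFinB ad2 -EFinM lee_fin mulrA divfK ?gt_eqF//.
apply: le_trans le1 _; apply: ge0_le_integral => //=.
- by move=> t _; rewrite lee_fin divr_ge0// ltW.
- apply: measurable_funS mF => // t /=; rewrite in_itv/= => /andP[xt _].
  by apply/halfline_gt0; apply: le_lt_trans xt; rewrite mulr_ge0// ltW.
move=> t; rewrite in_itv/= => /andP[xt ty].
have t0 : (0 < t)%R by apply: le_lt_trans xt; rewrite mulr_ge0// ltW.
have Kt : (K / (a * d))%:E <= K%:E * (t^-1)%:E.
  by rewrite -EFinM lee_fin ler_pM2l// lef_pV2 ?posrE.
apply: le_trans Kt _; apply: lee_wpmul2r; first by rewrite lee_fin invr_ge0 ltW.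
rewrite /K -poweR_EFin; apply: le_poweR; first exact: ltW.
  by rewrite lee_fin mulr_ge0 ?powR_ge0// ltW.
have le_ta : rearr g (a * d)%R <= rearr g t by exact: rearr_nonincreasing.
(* Both factors are bounded below separately: the rearrangement by its value at the right end, the
   power by its value at the left end. *)
apply: (@le_trans _ _ ((t `^ p^-1)%:E * rearr g (a * d)%R)); last first.
  by apply: lee_wpmul2l => //; rewrite lee_fin powR_ge0.
apply: (@le_trans _ _ (((a * (d / 2)) `^ p^-1)%:E * rearr g (a * d)%R)); last first.
  apply: lee_wpmul2r; first exact: rearr_ge0.
  by rewrite lee_fin ge0_ler_powR ?nnegrE ?invr_ge0 ?mulr_ge0// ltW.
have -> : ((a * (d / 2)) `^ p^-1 = (d / 2) `^ p^-1 * a `^ p^-1)%R.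
  by rewrite powRM ?(mulrC (a `^ _)%R)// ltW.
rewrite EFinM [X in _ <= X * _]EFinM -muleA.
by apply: lee_wpmul2l => //; rewrite lee_fin powR_ge0.
Qed.

(** * Maximal non-compactness *)

Lemma lorentz_norm_ge0 {R : realType} (p q : R) (f : R -> R) : 0 <= lorentz_norm p q f.
Proof. exact: poweR_ge0. Qed.

Lemma lorentz_norm_cst0 {R : realType} (p q : R) : (0 < q)%R ->
  lorentz_norm p q (cst 0%R : R -> R) = 0.
Proof.
move=> q0; rewrite lorentz_normE integral0_eq ?poweR0r ?invr_eq0 ?gt_eqF//.
move=> t /halfline_gt0 t0; rewrite /lorentz_integrand.
suff -> : rearr (cst 0%R : R -> R) t = 0 by rewrite mule0 poweR0r ?gt_eqF// mul0e.
apply/eqP; rewrite eq_le rearr_ge0 andbT; apply: rearr_le => //.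
rewrite /distf (_ : _ `&` _ = set0) ?measure0 ?lee_fin ?ltW//.
by apply/seteqP; split=> // x [_ /=]; rewrite normr0 ltxx.
Qed.

Lemma in_lorentz_cst0 {R : realType} (p q : R) : (0 < q)%R ->
  in_lorentz p q (cst 0%R : R -> R).
Proof. by move=> q0; split; [exact: measurable_cst|rewrite lorentz_norm_cst0]. Qed.

(** A single ball centered at 0 covers the image. Since radii are positive reals, a finite norm is
    enlarged by an arbitrary [e], which also handles norm 0. *)
Lemma laplace_alpha_le_norm {R : realType} (p q p' r : R) : (0 < q)%R -> (0 < r)%R ->
  laplace_alpha p q p' r <= laplace_norm p q p' r.
Proof.
move=> q0 r0; set N := laplace_norm p q p' r.
have N0 : 0 <= N.
  apply: le_trans (ereal_sup_ubound _); first exact: (lorentz_norm_ge0 p' r (laplace (cst 0%R))).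
  exists (cst 0%R) => //; split; first exact: in_lorentz_cst0.
  by rewrite lorentz_norm_cst0.
have le_N (rho : R) : (0 < rho)%R -> N <= rho%:E -> laplace_alpha p q p' r <= rho%:E.
  move=> rho0 Nrho; apply: ereal_inf_lbound; exists rho => //; split => //.
  exists 1%N, (fun=> cst 0%R); split => [i _|f Bf]; first exact: in_lorentz_cst0.
  exists 0%N; split => //; apply: le_trans Nrho; apply: ereal_sup_ubound.
  have -> : (fun t => laplace f t - cst 0 t)%R = laplace f.
    by apply/funext => t; exact: subr0.
  by exists f.
case: N N0 le_N => [x||] //.
rewrite lee_fin => x0 le_N; apply/lee_addgt0Pr => e e0; rewrite -EFinD; apply: le_N.
  by rewrite ltr_wpDl.
by rewrite lee_fin lerDl ltW.
by move=> _ _; exact: leey.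
Qed.

Lemma lorentz_ball_dilation {R : realType} (p q b : R) (f : R -> R) : (0 < b)%R ->
  lorentz_ball p q f -> lorentz_ball p q (fun x => b `^ p^-1 * f (b * x))%R.
Proof.
move=> b0 [[mf foo] f1]; split; last by rewrite lorentz_norm_dilation.
split; last by rewrite lorentz_norm_dilation.
by apply: measurable_funM => //; exact: measurable_fun_dilation.
Qed.

Lemma laplace_norm_le_alpha {R : realType} (p q p' r : R) :
  (0 < p')%R -> (0 < r)%R -> p'^-1%R = (1 - p^-1)%R ->
  laplace_norm p q p' r <= laplace_alpha p q p' r.
Proof.
move=> p'0 r0 pp'; apply: le_ereal_inf_tmp => _ [rho [rho0 [m [g [Lg cover]]]] <-].
apply: ge_ereal_sup => _ [f Bf <-]; set h := laplace f.
have rho_root : rho%:E = (rho%:E `^ r) `^ r^-1.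
  by rewrite -poweRrM divff ?gt_eqF// poweRe1// lee_fin ltW.
rewrite rho_root lorentz_normE; apply: le_poweR.
- by rewrite invr_ge0 ltW.
- by apply: integral_ge0 => t; exact: lorentz_integrand_ge0.
(* Each level [e] is treated on its own: the dilation [a] and the index of the covering ball may
   change with [e]. *)
apply: lorentz_integral_truncated_le => // n; set e := (n.+1%:R^-1)%R.
have e0 : (0 < e)%R by rewrite invr_gt0.
have /choice[A AP] : forall i, exists A : R, (i < m)%N -> forall a : R, (0 < a)%R ->
    (A <= a)%R -> distf (fun x => a `^ p'^-1 * g i (a * x))%R e <= e%:E.
  move=> i; case: (ltnP i m) => [im|mi]; last by exists 0%R.
  have [A AP] := distf_dilation_le p'0 r0 e0 e0 (Lg i im).
  by exists A.
(* One dilation serves all centers; the initial value 1 keeps [a] positive even when the thresholds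
   are not. *)
pose a : R := \big[Num.max/1%R]_(i < m) A i.
have a0 : (0 < a)%R by apply: lt_le_trans (bigmax_ge_id _ _ _ _).
(* The cover is applied to the dilated function rather than to [f]; dilating back moves the center
   instead. *)
have [i [im le_rho]] := cover _ (lorentz_ball_dilation a0 Bf).
have ge : distf (fun x => a `^ p'^-1 * g i (a * x))%R e <= e%:E.
  by apply: AP => //; exact: (le_bigmax _ (fun i : 'I_m => A i) (Ordinal im)).
have hE : (fun x => h x - a `^ p'^-1 * g i (a * x))%R = (fun x => a `^ p'^-1 *
    ((fun t => laplace (fun x => a `^ p^-1 * f (a * x)) t - g i t) (a * x)))%R.
  apply/funext => x; rewrite laplace_dilation ?powR_gt0//; last by case: Bf => -[].
  (* Conjugacy of the exponents cancels the Jacobian 1 / a of the Laplace transform. *)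
  have a_pow : (a `^ p'^-1 * (a `^ p^-1 / a) = 1)%R.
    rewrite mulrA -powRD; last by rewrite (gt_eqF a0) implybT.
    by rewrite pp' subrK powRr1 ?divff ?gt_eqF// ltW.
  by rewrite mulrBr mulrA (mulrC a x) mulfK ?gt_eqF// a_pow mul1r.
have le_int : \int[lebesgue_measure]_(t in halfline)
    lorentz_integrand p' r (rearr (fun x => h x - a `^ p'^-1 * g i (a * x))%R) t <= rho%:E `^ r.
  (* The isometry of dilations transfers the covering estimate to the difference of [h] and the
     dilated center. *)
  move: le_rho; rewrite -(lorentz_norm_dilation _ _ _ a0) -hE lorentz_normE.
  set I := (\int[_]_(_ in _) _) => le_rho.
  have I0 : 0 <= I by apply: integral_ge0 => t; exact: lorentz_integrand_ge0.
  rewrite -[I]poweRe1// -(mulVf (lt0r_neq0 r0)) poweRrM.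
  by apply: le_poweR => //; [exact: ltW|exact: poweR_ge0].
apply: le_trans le_int; apply: ge0_le_integral => //.
- exact: measurable_halfline.
- by move=> t; exact: lorentz_integrand_ge0.
- by apply: measurable_lorentz_integrand; apply: measurable_truncated_rearr; exact: ltW.
- by apply: measurable_lorentz_integrand; exact: measurable_rearr.
move=> t ht; apply: lorentz_integrand_le => //; first exact: ltW.
  by rewrite /truncated_rearr le_max lexx orbT.
by apply: truncated_rearr_le => //; exact: ltW.
Qed.

Local Close Scope ereal_scope.
Local Close Scope classical_set_scope.

Theorem theorem1 (R : realType) (p q r : R) :
  1 < p -> 1 < q -> q <= r ->
  laplace_alpha p q (p / (p - 1)) r = laplace_norm p q (p / (p - 1)) r.
Proof.
move=> p1 q1 qr.
have q0 : 0 < q := lt_trans ltr01 q1.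
have r0 : 0 < r := lt_le_trans q0 qr.
have p0 : 0 < p := lt_trans ltr01 p1.
have p10 : 0 < p - 1 by rewrite subr_gt0.
apply/eqP; rewrite eq_le laplace_alpha_le_norm//=.
apply: laplace_norm_le_alpha => //; first exact: divr_gt0.
by rewrite invf_div mulrBl divff ?gt_eqF// div1r.
Qed.
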